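(* Let $X$ be a finite set with $|X|\ge 3$, let $M$ be a set, and let $\delta:\binom X3\to M$ be any map (a three-way symbolic map on $X$). Then there exist a split system $\mathcal S$ on $X$ and a labelling map $l: V-\{\phi_x: x\in X\}\to M$, where $V$ is the vertex set of the Buneman graph $\mathcal B(\mathcal S)$, such that $\delta(Y)=l(\phi_Y)$ for all $Y\in\binom X3$, where $\phi_Y$ is the median in $\mathcal B(\mathcal S)$ of the three leaves $\phi_x$, $x\in Y$.
   Context: Let $X$ be a finite set with $|X|\ge 3$; $\binom X3$ is the set of 3-element subsets of $X$. A split of $X$ is an unordered bipartition $A|B=B|A$ of $X$ into two non-empty disjoint subsets (its parts) with $A\cup B=X$. It is trivial if one of its parts has size 1. A split system on $X$ is a set $\mathcal S$ of splits of $X$ that contains all trivial splits $\{x\}|X-\{x\}$, $x\in X$. For $S\in\mathcal S$ and $x\in X$, $S(x)$ denotes the part of $S$ containing $x$. The Buneman graph $\mathcal B(\mathcal S)$ has as vertices all maps $\phi:\mathcal S\to\mathcal P(X)$ such that (B1) $\phi(S)\in S$ for all $S\in\mathcal S$, and (B2) $\phi(S)\cap\phi(S')\ne\emptyset$ for all distinct $S,S'\in\mathcal S$. Two vertices $\phi,\phi'$ are adjacent if there is a unique $S\in\mathcal S$ with $\phi(S)\neq\phi'(S)$. For $x\in X$, $\phi_x$ denotes the vertex $S\mapsto S(x)$, which is a leaf (degree-one vertex) of $\mathcal B(\mathcal S)$; the leaf set is identified with $X$. It is known that $\mathcal B(\mathcal S)$ is a median graph, i.e. it is connected and any three vertices $u,v,w$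 have a unique median (a vertex lying on shortest paths between each pair of $u,v,w$). *)

(* Defs.v *)
From HB Require Import structures.
From mathcomp Require Import all_boot.

Set Implicit Arguments.
Unset Strict Implicit.
Unset Printing Implicit Defensive.

Section Graph.
Variables (V : Type) (adj : rel V).

Definition walk (u v : V) (p : seq V) : Prop := path adj u p /\ last u p = v.

Definition shortest_path (u v : V) (p : seq V) : Prop :=
  walk u v p /\ forall q : seq V, walk u v q -> size p <= size q.

End Graph.

Section Median.
Variables (V : eqType) (adj : rel V).

Definition on_shortest_path (u v m : V) : Prop :=
  exists2 p : seq V, shortest_path adj u v p & m \in u :: p.

Definition is_median (u v w m : V) : Prop :=
  [/\ on_shortest_path u v m, on_shortest_path v w m & on_shortest_path u w m].

End Median.

Section Splits.
Variable X : finType.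

Definition triple : Type := {Y : {set X} | #|Y| == 3}.

(* A split A|B is the set {A, B} of its parts; [partition] excludes empty
   parts. *)
Definition is_split (S : {set {set X}}) : bool :=
  partition S [set: X] && (#|S| == 2).

Definition xsplit : Type := {S : {set {set X}} | is_split S}.

Definition trivial_split (S : xsplit) : bool :=
  [exists A in val S, #|A| == 1].

Definition is_split_system (SS : {set xsplit}) : bool :=
  [forall S : xsplit, trivial_split S ==> (S \in SS)].

Definition split_system : Type := {SS : {set xsplit} | is_split_system SS}.

(* S(x) *)
Definition part_of (S : xsplit) (x : X) : {set X} := pblock (val S) x.

Lemma part_of_mem (S : xsplit) (x : X) : part_of S x \in val S.
Proof.
case/andP: (valP S) => /and3P[/eqP covS _ _] _.
by apply: pblock_mem; rewrite covS inE.
Qed.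

Lemma mem_part_of (S : xsplit) (x : X) : x \in part_of S x.
Proof.
case/andP: (valP S) => /and3P[/eqP covS _ _] _.
by rewrite /part_of mem_pblock covS inE.
Qed.

End Splits.

Section Buneman.
Variables (X : finType) (SS : split_system X).

Definition member_split : Type := {S : xsplit X | S \in val SS}.

Definition is_buneman_vertex (phi : {ffun member_split -> {set X}}) : bool :=
  [forall S : member_split, phi S \in val (val S)] &&
  [forall S : member_split, forall S' : member_split,
     (S != S') ==> (phi S :&: phi S' != set0)].

Definition buneman_vertex : Type :=
  {phi : {ffun member_split -> {set X}} | is_buneman_vertex phi}.

Definition buneman_adj : rel buneman_vertex :=
  fun phi psi => #|[set S : member_split | val phi S != val psi S]| == 1.

Definition leaf_map (x : X) : {ffun member_split -> {set X}} :=
  [ffun S : member_split => part_of (val S) x].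

Lemma leaf_map_vertex (x : X) : is_buneman_vertex (leaf_map x).
Proof.
apply/andP; split; first by apply/forallP => S; rewrite ffunE part_of_mem.
apply/forallP => S; apply/forallP => S'; apply/implyP => _.
by apply/set0Pn; exists x; rewrite inE !ffunE !mem_part_of.
Qed.

(* phi_x *)
Definition leaf (x : X) : buneman_vertex :=
  exist _ (leaf_map x) (leaf_map_vertex x).

Definition interior_vertex : Type :=
  {v : buneman_vertex | v \notin codom leaf}.

End Buneman.

(* Main.v *)
Require Import Defs.
From HB Require Import structures.
From mathcomp Require Import all_boot.

Set Implicit Arguments.
Unset Strict Implicit.
Unset Printing Implicit Defensive.

(** Take for SS the set of all splits.  The distance of two Buneman vertices
    is the number of splits on which they differ, so the median of three
    vertices is their pointwise majority.  For three leaves x, y, z the majority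
    picks in every split the part containing at least two elements of
    Y = {x, y, z}.  This vertex determines Y: if Y' is another triple,
    c is in Y but not in Y', and a is another element of Y, then the split
    {a, c} | X - {a, c} separates the vertices of Y and Y'.  Hence delta factors
    through the median, and the trivial splits show that this is not a leaf. *)

(** * Splits as pairs of complementary parts *)

Section SplitParts.
Variable X : finType.
Implicit Types (S : xsplit X) (A B : {set X}).

(** The two blocks are disjoint and cover [X], so each is the complement of the other. *)
Lemma split_valE S A : A \in val S -> val S = [set A; ~: A].
Proof.
case/andP: (valP S) => partS /cards2P[A1 [A2 [neqA defS]]].
have [covS trivS _] := and3P partS.
have dis : [disjoint A1 & A2].
  by apply: (trivIsetP trivS) => //; rewrite defS !inE eqxx ?orbT.
have cov : A1 :|: A2 = setT.
  by rewrite -(eqP covS) defS /cover bigcup_setU !big_set1.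
have compl : A2 = ~: A1.
  apply/setP=> x; have := in_setT x; rewrite -cov !inE.
  by case: (boolP (x \in A1)) => [/(disjointFr dis) -> | _ /= ->].
rewrite defS !inE => /orP[] /eqP ->; first by rewrite compl.
by rewrite compl setCK setUC.
Qed.

Lemma split_part_compl S A B :
  A \in val S -> B \in val S -> A != B -> B = ~: A.
Proof.
by move=> /split_valE -> /set2P[] -> //; rewrite eqxx.
Qed.

Lemma split_part_inj S S' A : A \in val S -> A \in val S' -> S = S'.
Proof.
move=> /split_valE defS /split_valE defS'.
by apply: val_inj; rewrite defS.
Qed.

Lemma is_split_compl A : A != set0 -> ~: A != set0 -> is_split [set A; ~: A].
Proof.
move=> A0 CA0.
have neq : A != ~: A.
  apply: contra A0 => /eqP eqA.
  by rewrite -(setIid A) {2}eqA setICr.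
rewrite /is_split cards2 neq andbT; apply/and3P; split.
- by rewrite /cover bigcup_setU !big_set1 setUCr.
- apply/trivIsetP=> B C /set2P[] -> /set2P[] ->; rewrite ?eqxx //= => _.
    by rewrite -setI_eq0 setICr.
  by rewrite -setI_eq0 setIC setICr.
- by rewrite !inE ![set0 == _]eq_sym (negbTE A0) (negbTE CA0).
Qed.

End SplitParts.

(** * Majority among three values *)

Variant majority_spec (T : Type) (a b c : T) : T -> Prop :=
  | MajorityAB of a = b : majority_spec a b c a
  | MajorityAC of a = c : majority_spec a b c a
  | MajorityBC of b = c : majority_spec a b c b.

Lemma majority_spec_among (T : Type) (a b c d : T) :
  majority_spec a b c d -> [/\ d = a \/ d = b, d = b \/ d = c & d = a \/ d = c].
Proof. by case=> ->; split; auto. Qed.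

(** The three disjunctions are what betweenness on the three sides of a triangle says at a single
    split; this gives uniqueness of medians. *)
Lemma majority_spec_uniq (T : Type) (a b c d e : T) :
  majority_spec a b c d ->
  e = a \/ e = b -> e = b \/ e = c -> e = a \/ e = c -> e = d.
Proof. by case=> eqs [|] ? [|] ? [|] ?; congruence. Qed.

(* Two majorities among three voters share a voter. *)
Lemma majority_spec_rel (T U : Type) (R : T -> U -> Prop) a b c d a' b' c' d' :
  majority_spec a b c d -> majority_spec a' b' c' d' ->
  R a a' -> R b b' -> R c c' -> R d d'.
Proof. by case=> ?; case=> ? *; subst. Qed.

(** * Distance and betweenness in the Buneman graph *)

Section BunemanMedian.
Variables (X : finType) (SS : split_system X).
Local Notation V := (buneman_vertex SS).
Local Notation adj := (@buneman_adj X SS).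
Implicit Types (u v w m : V) (S : member_split SS).

Lemma vertex_part u S : val u S \in val (val S).
Proof. by case/andP: (valP u) => /forallP. Qed.

Lemma vertex_meet u S S' : S != S' -> val u S :&: val u S' != set0.
Proof. by case/andP: (valP u) => _ /forallP/(_ S)/forallP/(_ S')/implyP. Qed.

Lemma vertex_eqP u v : (forall S, val u S = val v S) -> u = v.
Proof. by move=> eq_uv; apply/val_inj/ffunP. Qed.

Definition vdiff u v : {set member_split SS} := [set S | val u S != val v S].

Lemma in_vdiff u v S : (S \in vdiff u v) = (val u S != val v S).
Proof. by rewrite inE. Qed.

Lemma vdiff_triangle u v w : vdiff u w \subset vdiff u v :|: vdiff v w.
Proof.
apply/subsetP=> S; rewrite !(inE, in_vdiff); apply: contraR.
by rewrite negb_or !negbK => /andP[/eqP -> /eqP ->].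
Qed.

Lemma vdiff_eq0 u v : vdiff u v = set0 -> u = v.
Proof.
move=> /setP uv0; apply: vertex_eqP => S; apply/eqP/negPn.
by rewrite -in_vdiff uv0 inE.
Qed.

(** Each edge of the walk changes the vertex at exactly one split. *)
Lemma walk_vdiff u v p : walk adj u v p -> #|vdiff u v| <= size p.
Proof.
elim: p u => [|w p IHp] u [] /=.
  move=> _ <-; rewrite leqn0 cards_eq0; apply/eqP/setP=> S.
  by rewrite !(inE, in_vdiff) eqxx.
case/andP=> uw pw lw; have wv := IHp w (conj pw lw).
apply: leq_trans (subset_leq_card (vdiff_triangle u w v)) _.
apply: leq_trans (leq_card_setU _ _) _.
by rewrite (eqP uw) add1n ltnS.
Qed.

(* Switching u at a split S of vdiff u v with u(S) minimal keeps the vertex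
   axioms: v(S) disjoint from u(S') would force u(S') to lie inside u(S). *)
Lemma vertex_step u v :
  vdiff u v != set0 ->
  exists2 w, adj u w & exists2 S, S \in vdiff u v & vdiff w v = vdiff u v :\ S.
Proof.
case/set0Pn=> S0 S0in.
have [S Sin minS] : exists2 S, S \in vdiff u v &
    forall T, T \in vdiff u v -> #|val u S| <= #|val u T|.
  by case: (arg_minnP (fun S => #|val u S|) S0in) => S; exists S.
have neqS : val u S != val v S by rewrite -in_vdiff.
pose f := [ffun T => if T == S then val v T else val u T] : {ffun _ -> {set X}}.
have meetS T : T != S -> val v S :&: val u T != set0.
  move=> neqT; have [Tin | ] := boolP (T \in vdiff u v); last first.
    by rewrite in_vdiff negbK => /eqP ->; apply: vertex_meet; rewrite eq_sym.
  apply/eqP=> vu0; case/negP: neqT; apply/eqP/val_inj.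
  (* The inclusion of [val u T] in [val u S] is an equality by minimality, and a split is determined
     by one of its parts, so [T] would be [S]. *)
  suff eqTS : val u T = val u S.
    by apply: (split_part_inj (vertex_part u T)); rewrite eqTS vertex_part.
  apply/eqP; rewrite eqEcard minS // andbT.
  have -> : val u S = ~: val v S.
    by apply: split_part_compl (vertex_part v S) (vertex_part u S) _; rewrite eq_sym.
  by rewrite -disjoints_subset -setI_eq0 setIC vu0.
have fP : is_buneman_vertex f.
  apply/andP; split.
    by apply/forallP=> T; rewrite ffunE; case: ifP => _; apply: vertex_part.
  apply/forallP=> T; apply/forallP=> T'; apply/implyP=> neqT; rewrite !ffunE.
  case: (eqVneq T S) => [eT|TS]; case: (eqVneq T' S) => [eT'|T'S].
  - by rewrite eT eT' eqxx in neqT.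
  - by rewrite eT; apply: meetS.
  - by rewrite setIC eT'; apply: meetS.
  - exact: vertex_meet.
exists (exist _ f fP).
  rewrite /buneman_adj; apply/cards1P; exists S; apply/setP=> T.
  by rewrite !(inE, in_vdiff) /= ffunE; case: (eqVneq T S) => [->|_] //; rewrite eqxx.
exists S => //; apply/setP=> T; rewrite !(inE, in_vdiff) /= ffunE.
by case: (eqVneq T S) => [->|_] //; rewrite eqxx.
Qed.

(** Repeated use of [vertex_step] attains the lower bound of [walk_vdiff], so the graph distance is
    the cardinality of [vdiff u v]. *)
Lemma vdiff_walk u v : exists2 p, walk adj u v p & size p = #|vdiff u v|.
Proof.
have [n] := ubnP #|vdiff u v|; elim: n u => // n IHn u.
have [/vdiff_eq0 -> _ | ] := eqVneq (vdiff u v) set0.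
  exists [::]; first by split.
  apply/esym/eqP; rewrite cards_eq0; apply/eqP/setP=> S.
  by rewrite !(inE, in_vdiff) eqxx.
case/vertex_step=> w uw [S Sin defw]; rewrite (cardsD1 S) Sin -defw.
rewrite add1n ltnS => /IHn[p [pw lw] sp].
by exists (w :: p); [split=> //=; rewrite uw | rewrite /= sp].
Qed.

(** Distances add up at [m] exactly when no split separates [m] from both [u] and [v], which turns
    betweenness into a condition on each split. *)
Lemma on_shortest_pathP u v m :
  on_shortest_path adj u v m <->
  (forall S, val m S = val u S \/ val m S = val v S).
Proof.
split.
  case=> p [[pu lu] minp] mp S; case/splitPl: mp pu lu minp => p1 p2 lm.
  rewrite cat_path last_cat lm => /andP[pu pm] lv minp.
  have [q quv sq] := vdiff_walk u v; have := minp q quv.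
  rewrite size_cat sq => le_uv.
  have le1 := walk_vdiff (conj pu lm); have le2 := walk_vdiff (conj pm lv).
  (* The cardinalities of [vdiff u m] and [vdiff m v] sum to at most that of their union, so their
     intersection is empty. *)
  have := subset_leq_card (vdiff_triangle u m v).
  move=> /(leq_trans (leq_trans (leq_add le1 le2) le_uv)).
  rewrite -cardsUI -[X in _ <= X]addn0 leq_add2l leqn0 cards_eq0 => /eqP/setP/(_ S).
  rewrite !(inE, in_vdiff).
  by case: eqP => [->|_]; [left | case: eqP => // ->; right].
move=> mS; have [p [pu lu] sp] := vdiff_walk u m.
have [q [qm lm] sq] := vdiff_walk m v.
exists (p ++ q); last first.
  by rewrite -cat_cons mem_cat -lu mem_last.
split; first by split; rewrite ?cat_path ?last_cat ?lu ?pu.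
move=> r /walk_vdiff; apply: leq_trans.
rewrite size_cat sp sq -cardsUI.
have -> : vdiff u m :&: vdiff m v = set0.
  by apply/setP=> S; rewrite !(inE, in_vdiff); case: (mS S) => ->; rewrite eqxx ?andbF.
rewrite cards0 addn0; apply/subset_leq_card/subsetP=> S; rewrite !(inE, in_vdiff).
by case: (mS S) => ->; rewrite eqxx ?orbF.
Qed.

(** * Medians as pointwise majorities *)

Definition majority u v w : {ffun member_split SS -> {set X}} :=
  [ffun S => if val u S == val v S then val u S else val w S].

(** A split has only two parts: if [u] and [v] choose different ones, [w] sides with one of them and
    decides. *)
Lemma majorityP u v w S :
  majority_spec (val u S) (val v S) (val w S) (majority u v w S).
Proof.
rewrite ffunE; case: eqVneq => [|neq]; first by constructor.
have := vertex_part w S.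
rewrite (split_valE (vertex_part u S)).
rewrite -(split_part_compl (vertex_part u S) (vertex_part v S) neq).
by case/set2P=> eqw; rewrite eqw; constructor.
Qed.

(** At any two splits some vertex among [u], [v], [w] belongs to both majorities, and (B2) for that
    vertex makes the chosen parts meet. *)
Lemma majority_vertex u v w : is_buneman_vertex (majority u v w).
Proof.
apply/andP; split.
  by apply/forallP=> S; case: (majorityP u v w S) => _; apply: vertex_part.
apply/forallP=> S; apply/forallP=> T; apply/implyP=> neq.
apply: (majority_spec_rel (R := fun A B => A :&: B != set0)
  (majorityP u v w S) (majorityP u v w T)); exact: vertex_meet.
Qed.

Definition median u v w : V := exist _ (majority u v w) (majority_vertex u v w).

Lemma is_medianP u v w m : is_median adj u v w m <-> m = median u v w.
Proof.
split.
  case=> /on_shortest_pathP uv /on_shortest_pathP vw /on_shortest_pathP uw.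
  apply: vertex_eqP => S.
  exact: majority_spec_uniq (majorityP u v w S) (uv S) (vw S) (uw S).
by move=> ->; split; apply/on_shortest_pathP=> S;
  case: (majority_spec_among (majorityP u v w S)).
Qed.

(** * Recovering a triple from its median *)

Definition backs u (Y : {set X}) : bool := [forall S, 1 < #|val u S :&: Y|].

(** Two of the three leaves agree at [S], so both of their labels lie in the majority part. *)
Lemma median_leaves_backs x y z :
  #|[set x; y; z]| = 3 ->
  backs (median (leaf SS x) (leaf SS y) (leaf SS z)) [set x; y; z].
Proof.
move=> card3; apply/forallP=> S /=.
have [xy xz yz] : [/\ x != y, x != z & y != z].
  move: card3; rewrite -setUA cardsU1 cards2 !inE negb_or.
  by case: (x != y); case: (x != z); case: (y != z).
have two (A : {set X}) a b : a != b -> a \in A -> b \in A ->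
    a \in [set x; y; z] -> b \in [set x; y; z] -> 1 < #|A :&: [set x; y; z]|.
  move=> ab aA bA aY bY; have <- : #|[set a; b]| = 2 by rewrite cards2 ab.
  by apply/subset_leq_card/subsetP=> c /set2P[] ->; rewrite inE ?aA ?bA.
have inS a : a \in val (leaf SS a) S by rewrite ffunE mem_part_of.
case: (majorityP (leaf SS x) (leaf SS y) (leaf SS z) S) => eqS.
- by apply: (two _ _ _ xy); rewrite ?inS ?inE ?eqxx ?orbT // eqS inS.
- by apply: (two _ _ _ xz); rewrite ?inS ?inE ?eqxx ?orbT // eqS inS.
- by apply: (two _ _ _ yz); rewrite ?inS ?inE ?eqxx ?orbT // eqS inS.
Qed.

Lemma backs_not_leaf u (Y : {set X}) :
  1 < #|X| -> backs u Y -> u \notin codom (leaf SS).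
Proof.
move=> hX /forallP uY; apply/negP=> /codomP[x def_u].
have splitx : is_split [set [set x]; ~: [set x]].
  apply: is_split_compl; rewrite -card_gt0 ?cards1 //.
  by rewrite cardsC1 -subn1 subn_gt0.
pose S0 : xsplit X := exist _ [set [set x]; ~: [set x]] splitx.
have S0in : S0 \in val SS.
  have /forallP/(_ S0)/implyP := valP SS; apply.
  by apply/existsP; exists [set x]; rewrite !inE eqxx cards1.
(* At its own trivial split the leaf of [x] chooses the singleton of [x], too small to hold two
   elements of [Y]. *)
have := uY (exist _ S0 S0in); rewrite def_u /= ffunE /=.
have -> : part_of S0 x = [set x].
  have [_ trivS _] := and3P (proj1 (andP splitx)).
  by rewrite /part_of; apply: (def_pblock trivS); rewrite ?set11 ?set21.
by rewrite ltnNge (leq_trans (subset_leq_card (subsetIl _ _))) ?cards1.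
Qed.

End BunemanMedian.

(** * The system of all splits and the labelling *)

Lemma setT_split_system (X : finType) :
  is_split_system ([set: xsplit X] : {set xsplit X}).
Proof. by apply/forallP=> S; rewrite in_setT implybT. Qed.

Definition full_split_system (X : finType) : split_system X :=
  exist _ [set: xsplit X] (setT_split_system X).

Lemma backs_full_inj (X : finType) (u : buneman_vertex (full_split_system X))
    (Y Y' : {set X}) :
  #|Y| = 3 -> #|Y'| = 3 -> backs u Y -> backs u Y' -> Y = Y'.
Proof.
move=> cardY cardY' /forallP uY /forallP uY'.
apply/eqP; rewrite eqEcard cardY cardY' andbT; apply/negPn/negP.
case/subsetPn=> c cY cY'.
have /card_gt0P[a] : 0 < #|Y :\ c|.
  by move: cardY; rewrite (cardsD1 c) cY add1n => -[->].
rewrite !inE => /andP[ac aY].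
pose A := [set a; c].
have AY : A \subset Y by apply/subsetP=> d /set2P[] ->.
have cardA : #|A| = 2 by rewrite cards2 ac.
have cardCAY : #|~: A :&: Y| = 1.
  by apply/eqP; rewrite setIC -setDE cardsD (setIidPr AY) cardY cardA.
have cardAY' : #|A :&: Y'| <= 1.
  rewrite -(cards1 a); apply/subset_leq_card/subsetP=> d.
  by rewrite !inE => /andP[/orP[//|/eqP->]]; rewrite (negbTE cY').
have splitA : is_split [set A; ~: A].
  apply: is_split_compl; first by rewrite -card_gt0 cardA.
  rewrite -card_gt0; apply: leq_trans (subset_leq_card (subsetIl _ Y)).
  by rewrite cardCAY.
pose SA : xsplit X := exist _ [set A; ~: A] splitA.
pose S : member_split (full_split_system X) :=
  exist _ SA (in_setT SA).
(* Neither part is possible: [A] meets [Y'] at most in [a], and its complement meets [Y] in one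
   element only. *)
have /set2P[eqS|eqS] : val u S \in [set A; ~: A] := vertex_part u S.
  by have := uY' S; rewrite eqS ltnNge cardAY'.
by have := uY S; rewrite eqS cardCAY.
Qed.

Theorem mainTheorem6 (X : finType) (hX : 3 <= #|X|) (M : Type)
    (delta : triple X -> M) :
  exists (SS : split_system X) (l : interior_vertex SS -> M),
    forall (Y : triple X) (x y z : X), val Y = [set x; y; z] ->
      exists m : interior_vertex SS,
        (forall v : buneman_vertex SS,
           is_median (@buneman_adj X SS) (leaf SS x) (leaf SS y) (leaf SS z) v
           <-> v = val m)
        /\ delta Y = l m.
Proof.
(* Some triple exists as [X] has at least three elements; its value under [delta] serves as default
   label for vertices that back no triple. *)
have [Y0 _ cardY0] : exists2 Y0 : {set X}, true & #|Y0| == 3.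
  have [s /andP[us _] ss] : exists2 s : seq X, uniq s && true & size s = 3.
    by exists (take 3 (enum X)); rewrite ?take_uniq ?enum_uniq // size_takel // -cardE.
  by exists [set x in s]; rewrite // cardsE (card_uniqP us) ss.
pose SS := full_split_system X; exists SS.
pose l (m : interior_vertex SS) : M :=
  if [pick Y : {Y : {set X} | #|Y| == 3} | backs (val m) (val Y)] is Some Y
  then delta Y else delta (exist _ Y0 cardY0).
exists l => Y x y z defY.
have cardY : #|val Y| = 3 by apply/eqP/(valP Y).
pose v := median (leaf SS x) (leaf SS y) (leaf SS z).
have vY : backs v (val Y) by rewrite defY median_leaves_backs -?defY.
exists (exist _ v (backs_not_leaf (ltnW hX) vY)); split.
  by move=> w; apply: is_medianP.
(* The triple picked by [l] is backed by [v], as [Y] is, so the two coincide by [backs_full_inj]. *)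
rewrite /l; case: pickP => [Y' vY' | /(_ Y)]; last by rewrite vY.
congr delta; apply: val_inj.
exact: (backs_full_inj cardY (eqP (valP Y')) vY vY').
Qed.
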